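(* Let $f:\mathbb{H}\to\mathbb{H}$ be a slice regular function such that for every $\varepsilon>0$ one has $|f(q)|<e^{\varepsilon|q|}$ for all $q$ with $|q|$ sufficiently large (i.e. $f$ has order at most $1$ and type $0$). If for some $I\in\mathbb{S}$ the plane $L_I$ contains a (real) line on which $|f|$ is bounded, then $f$ is constant.
   Context: $\mathbb{H}$ denotes the quaternions with Euclidean norm $|q|$; $\mathbb{S}=\{ix_1+jx_2+kx_3: x_1^2+x_2^2+x_3^2=1\}$; for $I\in\mathbb{S}$, $L_I=\mathbb{R}+\mathbb{R}I$. A function $f:\mathbb{H}\to\mathbb{H}$ is slice regular if for every $I\in\mathbb{S}$ its restriction $f_I$ to $L_I$ satisfies $\frac12\left(\frac{\partial}{\partial x}+I\frac{\partial}{\partial y}\right)f_I(x+yI)=0$.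
   Formalization: Slice regularity is taken to include that each restriction to L_I has continuous partial derivatives; with mere existence of the partials the claim fails, e.g. for f(q)=exp(-q^{-4}), f(0)=0. *)

(* Defs.v *)
From Stdlib Require Import Reals Lra.
Open Scope R_scope.

(* Quaternions q = q0 + i q1 + j q2 + k q3. *)
Record quat : Type := mkQ { q0 : R; q1 : R; q2 : R; q3 : R }.

Definition qadd (p q : quat) : quat :=
  mkQ (q0 p + q0 q) (q1 p + q1 q) (q2 p + q2 q) (q3 p + q3 q).

Definition qmul (p q : quat) : quat :=
  mkQ (q0 p * q0 q - q1 p * q1 q - q2 p * q2 q - q3 p * q3 q)
      (q0 p * q1 q + q1 p * q0 q + q2 p * q3 q - q3 p * q2 q)
      (q0 p * q2 q - q1 p * q3 q + q2 p * q0 q + q3 p * q1 q)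
      (q0 p * q3 q + q1 p * q2 q - q2 p * q1 q + q3 p * q0 q).

Definition qreal (x : R) : quat := mkQ x 0 0 0.
Definition qscal (t : R) (q : quat) : quat :=
  mkQ (t * q0 q) (t * q1 q) (t * q2 q) (t * q3 q).

Definition qzero : quat := qreal 0.

Definition qnorm (q : quat) : R :=
  sqrt (q0 q ^ 2 + q1 q ^ 2 + q2 q ^ 2 + q3 q ^ 2).

Definition in_S (I : quat) : Prop :=
  q0 I = 0 /\ q1 I ^ 2 + q2 I ^ 2 + q3 I ^ 2 = 1.

Definition slice_pt (I : quat) (x y : R) : quat := qadd (qreal x) (qscal y I).

Definition in_L (I q : quat) : Prop := exists x y : R, q = slice_pt I x y.

Definition qderiv_lim (g : R -> quat) (t : R) (d : quat) : Prop :=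
  derivable_pt_lim (fun s => q0 (g s)) t (q0 d) /\
  derivable_pt_lim (fun s => q1 (g s)) t (q1 d) /\
  derivable_pt_lim (fun s => q2 (g s)) t (q2 d) /\
  derivable_pt_lim (fun s => q3 (g s)) t (q3 d).

Definition qcont2 (h : R -> R -> quat) : Prop :=
  forall x y eps, 0 < eps -> exists delta, 0 < delta /\
    forall x' y', Rabs (x' - x) < delta -> Rabs (y' - y) < delta ->
      qnorm (qadd (h x' y') (qscal (-1) (h x y))) < eps.

(* Slice regularity: for every I in S, the restriction f_I(x + yI) has
   (continuous) partial derivatives dx, dy satisfying the
   Cauchy-Riemann-Fueter equation (1/2)(d/dx + I d/dy) f_I = 0,
   i.e. dx + I * dy = 0 (left multiplication by I). *)
Definition slice_regular (f : quat -> quat) : Prop :=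
  forall I : quat, in_S I ->
    exists dx dy : R -> R -> quat,
      qcont2 dx /\ qcont2 dy /\
      (forall x y, qderiv_lim (fun s => f (slice_pt I s y)) x (dx x y)) /\
      (forall x y, qderiv_lim (fun s => f (slice_pt I x s)) y (dy x y)) /\
      (forall x y, qadd (dx x y) (qmul I (dy x y)) = qzero).

(* Main.v *)
(* Each coordinate of [f] on a slice [L_J] is the real part of an entire function [F] of
   exponential type zero. If [|F|^2 <= K] on a line, then [|F|^2 <= K] on the whole plane, by
   Phragmen-Lindelof: first on quadrants, with the weights [exp (i e z / 2 - d z / 2)], to
   get a bound [S_e exp (e y)], then on high strips. A bounded entire [F] is constant because
   [F (c + rho exp (i z)) - F c] is again bounded, and arbitrarily small on the real axis as
   [rho] tends to [0], hence small everywhere by the same result. So [f] is constant on [L_I],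
   in particular on the real line, which lies in all the other slices: the same argument
   applies to each of them. *)

Require Import Defs.
From Stdlib Require Import Reals Lra Psatz ClassicalEpsilon.
From Coquelicot Require Import Coquelicot.
Open Scope R_scope.

(** * Holomorphic functions as pairs of real functions *)

(** In a half plane, order one is the critical growth: [exp (- i z)] has modulus 1 on the real axis
    and is unbounded above it. So type zero has to be spent against a factor [exp (i e z / 2)]. The
    quadrants alone do not finish: [S_e] depends on the growth constant of [F] for the exponent [e],
    and nothing is known of it as [e] tends to 0. The strips remove it, because at a large height
    [Y] the factor [exp (- e Y)] beats [S exp (e Y / 2)], and the bound becomes [K] itself. Keeping
    [K] is what lets smallness on the axis pass to the whole plane in the constancy argument. *)

Lemma continuity_2d_pt_comp2 (f g h : R -> R -> R) (x y : R) :
  continuity_2d_pt f (g x y) (h x y) ->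
  continuity_2d_pt g x y -> continuity_2d_pt h x y ->
  continuity_2d_pt (fun s t => f (g s t) (h s t)) x y.
Proof.
  intros Hf Hg Hh eps.
  destruct (Hf eps) as [d Hd].
  apply locally_2d_impl with (2 := Hg d).
  apply locally_2d_impl with (2 := Hh d).
  apply locally_2d_forall. intros s t Hs Ht. now apply Hd.
Qed.

Lemma continuous_of_continuity_2d (f : R -> R -> R) (g h : R -> R) (t : R) :
  continuity_2d_pt f (g t) (h t) ->
  continuous g t -> continuous h t -> continuous (fun s => f (g s) (h s)) t.
Proof.
  intros Hf Hg Hh.
  apply continuity_2d_pt_filterlim in Hf.
  apply (continuous_comp_2 g h f); auto.
Qed.

Lemma differentiable_pt_lim_continuity (u : R -> R -> R) (x y lx ly : R) :
  differentiable_pt_lim u x y lx ly -> continuity_2d_pt u x y.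
Proof.
  intros H. apply differentiable_continuity_pt. now exists lx, ly.
Qed.

Lemma differentiable_pt_lim_fst (x y : R) :
  differentiable_pt_lim (fun s _ => s) x y 1 0.
Proof. apply differentiable_pt_lim_proj1_0 with (f := fun s => s), derivable_pt_lim_id. Qed.

Lemma differentiable_pt_lim_snd (x y : R) :
  differentiable_pt_lim (fun _ t => t) x y 0 1.
Proof.
  intros eps. exists (mkposreal 1 Rlt_0_1). intros s t _ _.
  replace (t - y - (0 * (s - x) + 1 * (t - y))) with 0 by ring.
  rewrite Rabs_R0. apply Rmult_le_pos; [ apply Rlt_le, cond_pos |].
  apply Rle_trans with (2 := Rmax_l _ _), Rabs_pos.
Qed.

Lemma differentiable_pt_lim_affine (x y c l m : R) :
  differentiable_pt_lim (fun s t => c + l * s + m * t) x y l m.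
Proof.
  intros eps. exists (mkposreal 1 Rlt_0_1). intros s t _ _.
  replace (c + l * s + m * t - (c + l * x + m * y) - _) with 0 by ring.
  rewrite Rabs_R0. apply Rmult_le_pos; [ apply Rlt_le, cond_pos |].
  apply Rle_trans with (2 := Rmax_l _ _), Rabs_pos.
Qed.

Lemma differentiable_pt_lim_prod (x y : R) :
  differentiable_pt_lim (fun s t => s * t) x y y x.
Proof.
  (* The remainder is the product of the two increments, so [eps] itself serves as radius. *)
  intros eps. exists eps. intros s t Hs Ht.
  replace (s * t - x * y - (y * (s - x) + x * (t - y))) with ((s - x) * (t - y)) by ring.
  rewrite Rabs_mult. apply Rmult_le_compat; try apply Rabs_pos.
  - now apply Rlt_le.
  - apply Rmax_r.
Qed.

Lemma differentiable_pt_lim_mult (f g : R -> R -> R) (x y fx fy gx gy : R) :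
  differentiable_pt_lim f x y fx fy -> differentiable_pt_lim g x y gx gy ->
  differentiable_pt_lim (fun s t => f s t * g s t) x y
    (fx * g x y + f x y * gx) (fy * g x y + f x y * gy).
Proof.
  intros Hf Hg.
  replace (fx * g x y + f x y * gx) with (g x y * fx + f x y * gx) by ring.
  replace (fy * g x y + f x y * gy) with (g x y * fy + f x y * gy) by ring.
  apply differentiable_pt_lim_comp with (f1 := fun s t => s * t); auto.
  apply differentiable_pt_lim_prod.
Qed.

Lemma differentiable_pt_lim_lin (f g : R -> R -> R) (x y fx fy gx gy c l m : R) :
  differentiable_pt_lim f x y fx fy -> differentiable_pt_lim g x y gx gy ->
  differentiable_pt_lim (fun s t => c + l * f s t + m * g s t) x y
    (l * fx + m * gx) (l * fy + m * gy).
Proof.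
  intros Hf Hg.
  apply differentiable_pt_lim_comp with (f1 := fun s t => c + l * s + m * t); auto.
  apply differentiable_pt_lim_affine.
Qed.

Lemma differentiable_pt_lim_eq (f g : R -> R -> R) (x y fx fy gx gy : R) :
  differentiable_pt_lim f x y fx fy -> (forall s t, f s t = g s t) ->
  fx = gx -> fy = gy -> differentiable_pt_lim g x y gx gy.
Proof.
  intros H Hfg <- <-. apply differentiable_pt_lim_ext with (2 := H).
  apply locally_2d_forall, Hfg.
Qed.

(** Passes from the partial derivatives given by [slice_regular] to the total differentiability
    required by [hol]. *)
Lemma differentiable_pt_lim_C1 (f fx fy : R -> R -> R) :
  (forall x y, derivable_pt_lim (fun s => f s y) x (fx x y)) ->
  (forall x y, derivable_pt_lim (fun t => f x t) y (fy x y)) ->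
  (forall x y, continuity_2d_pt fx x y) ->
  forall x y, differentiable_pt_lim f x y (fx x y) (fy x y).
Proof.
  intros Hx Hy Hc x y. apply filterdiff_differentiable_pt_lim.
  apply (is_derive_filterdiff f x y fx (fy x y)).
  - apply filter_forall. intros z. apply is_derive_Reals, Hx.
  - apply is_derive_Reals, Hy.
  - apply continuity_2d_pt_filterlim, Hc.
Qed.

(* [u + i v] is holomorphic with derivative [a + i b]. *)
Definition hol (u v : R -> R -> R) : Prop :=
  exists a b : R -> R -> R,
    (forall x y, differentiable_pt_lim u x y (a x y) (- b x y)) /\
    (forall x y, differentiable_pt_lim v x y (b x y) (a x y)) /\
    (forall x y, continuity_2d_pt a x y) /\
    (forall x y, continuity_2d_pt b x y).

Lemma hol_continuity_l (u v : R -> R -> R) :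
  hol u v -> forall x y, continuity_2d_pt u x y.
Proof. intros (a & b & Hu & _) x y. exact (differentiable_pt_lim_continuity _ _ _ _ _ (Hu x y)). Qed.

Lemma hol_continuity_r (u v : R -> R -> R) :
  hol u v -> forall x y, continuity_2d_pt v x y.
Proof. intros (a & b & _ & Hv & _) x y. exact (differentiable_pt_lim_continuity _ _ _ _ _ (Hv x y)). Qed.

Lemma hol_ext (u v u' v' : R -> R -> R) :
  (forall x y, u x y = u' x y) -> (forall x y, v x y = v' x y) ->
  hol u v -> hol u' v'.
Proof.
  intros E E' (a & b & Hu & Hv & Ha & Hb). exists a, b.
  repeat split; auto; intros x y.
  - now apply differentiable_pt_lim_eq with (1 := Hu x y).
  - now apply differentiable_pt_lim_eq with (1 := Hv x y).
Qed.

Lemma hol_comp (u v p q : R -> R -> R) :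
  hol u v -> hol p q ->
  hol (fun x y => u (p x y) (q x y)) (fun x y => v (p x y) (q x y)).
Proof.
  intros (a & b & Hu & Hv & Ha & Hb) H.
  pose proof (hol_continuity_l _ _ H) as Cp.
  pose proof (hol_continuity_r _ _ H) as Cq.
  destruct H as (c & d & Hp & Hq & Hc & Hd).
  (* Real and imaginary parts of the chain rule product [(a + i b) (c + i d)]. *)
  exists (fun x y => a (p x y) (q x y) * c x y - b (p x y) (q x y) * d x y),
         (fun x y => a (p x y) (q x y) * d x y + b (p x y) (q x y) * c x y).
  repeat split; intros x y.
  - eapply differentiable_pt_lim_eq.
    + apply (differentiable_pt_lim_comp u p q); eauto.
    + reflexivity.
    + ring.
    + ring.
  - eapply differentiable_pt_lim_eq.
    + apply (differentiable_pt_lim_comp v p q); eauto.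
    + reflexivity.
    + ring.
    + ring.
  - apply continuity_2d_pt_minus; apply continuity_2d_pt_mult; auto;
      apply continuity_2d_pt_comp2; auto.
  - apply continuity_2d_pt_plus; apply continuity_2d_pt_mult; auto;
      apply continuity_2d_pt_comp2; auto.
Qed.

Lemma hol_mult (u v p q : R -> R -> R) :
  hol u v -> hol p q ->
  hol (fun x y => u x y * p x y - v x y * q x y)
      (fun x y => u x y * q x y + v x y * p x y).
Proof.
  intros H H'.
  pose proof (hol_continuity_l _ _ H) as Cu.
  pose proof (hol_continuity_r _ _ H) as Cv.
  pose proof (hol_continuity_l _ _ H') as Cp.
  pose proof (hol_continuity_r _ _ H') as Cq.
  destruct H as (a & b & Hu & Hv & Ha & Hb).
  destruct H' as (c & d & Hp & Hq & Hc & Hd).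
  exists (fun x y => (a x y * p x y - b x y * q x y) + (u x y * c x y - v x y * d x y)),
         (fun x y => (a x y * q x y + b x y * p x y) + (u x y * d x y + v x y * c x y)).
  repeat split; intros x y.
  - eapply differentiable_pt_lim_eq.
    + eapply (differentiable_pt_lim_lin (fun x y => u x y * p x y) (fun x y => v x y * q x y)
                x y) with (c := 0) (l := 1) (m := -1); apply differentiable_pt_lim_mult; eauto.
    + intros; simpl; ring.
    + ring.
    + ring.
  - eapply differentiable_pt_lim_eq.
    + eapply (differentiable_pt_lim_lin (fun x y => u x y * q x y) (fun x y => v x y * p x y)
                x y) with (c := 0) (l := 1) (m := 1); apply differentiable_pt_lim_mult; eauto.
    + intros; simpl; ring.
    + ring.
    + ring.
  - apply continuity_2d_pt_plus; apply continuity_2d_pt_minus; apply continuity_2d_pt_mult; auto.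
  - repeat apply continuity_2d_pt_plus; apply continuity_2d_pt_mult; auto.
Qed.

(** The map [z -> (a1 + i a2) + (b1 + i b2) z]. Its instances supply translations, rotations and the
    exponents of the weights. *)
Lemma hol_affine (a1 a2 b1 b2 : R) :
  hol (fun x y => a1 + b1 * x - b2 * y) (fun x y => a2 + b2 * x + b1 * y).
Proof.
  exists (fun _ _ => b1), (fun _ _ => b2).
  repeat split; intros x y; try apply continuity_2d_pt_const.
  - eapply differentiable_pt_lim_eq;
      [ apply (differentiable_pt_lim_affine x y a1 b1 (- b2)) | intros; simpl; ring | ring | ring ].
  - apply differentiable_pt_lim_affine.
Qed.

Lemma hol_exp : hol (fun x y => exp x * cos y) (fun x y => exp x * sin y).
Proof.
  assert (He : forall x y, continuity_2d_pt (fun s _ => exp s) x y).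
  { intros x y. apply (continuity_1d_2d_pt_comp exp (fun s _ => s)).
    - apply derivable_continuous_pt, derivable_pt_exp.
    - apply continuity_2d_pt_id1. }
  assert (Hc : forall x y, continuity_2d_pt (fun _ t => cos t) x y).
  { intros x y. apply (continuity_1d_2d_pt_comp cos (fun _ t => t)).
    - apply continuity_cos.
    - apply continuity_2d_pt_id2. }
  assert (Hs : forall x y, continuity_2d_pt (fun _ t => sin t) x y).
  { intros x y. apply (continuity_1d_2d_pt_comp sin (fun _ t => t)).
    - apply continuity_sin.
    - apply continuity_2d_pt_id2. }
  exists (fun x y => exp x * cos y), (fun x y => exp x * sin y).
  repeat split; intros x y; try (apply continuity_2d_pt_mult; auto).
  - apply (differentiable_pt_lim_C1 (fun x y => exp x * cos y) (fun x y => exp x * cos y)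
             (fun x y => - (exp x * sin y))).
    + intros s t. apply is_derive_Reals. auto_derive; auto. ring.
    + intros s t. apply is_derive_Reals. auto_derive; auto. ring.
    + intros. apply continuity_2d_pt_mult; auto.
  - apply (differentiable_pt_lim_C1 (fun x y => exp x * sin y) (fun x y => exp x * sin y)
             (fun x y => exp x * cos y)).
    + intros s t. apply is_derive_Reals. auto_derive; auto. ring.
    + intros s t. apply is_derive_Reals. auto_derive; auto. ring.
    + intros. apply continuity_2d_pt_mult; auto.
Qed.

(** This is the conjugate of [F (- conj z)]. It exchanges the two upper quadrants while keeping the
    real axis, where the bound is known. *)
Lemma hol_reflect (u v : R -> R -> R) :
  hol u v -> hol (fun x y => u (- x) y) (fun x y => - v (- x) y).
Proof.
  intros (a & b & Hu & Hv & Ha & Hb).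
  assert (C : forall f, (forall x y, continuity_2d_pt f x y) ->
                forall x y, continuity_2d_pt (fun s t => f (- s) t) x y).
  { intros f Hf x y. apply (continuity_2d_pt_comp2 f (fun s _ => - s) (fun _ t => t)); auto.
    - apply continuity_2d_pt_opp, continuity_2d_pt_id1.
    - apply continuity_2d_pt_id2. }
  assert (D : forall f l m x y, differentiable_pt_lim f (- x) y l m ->
                differentiable_pt_lim (fun s t => f (- s) t) x y (- l) m).
  { intros f l m x y Hf. eapply differentiable_pt_lim_eq.
    - apply (differentiable_pt_lim_comp f (fun s t => 0 + (-1) * s + 0 * t) (fun _ t => t)).
      + replace (0 + -1 * x + 0 * y) with (- x) by ring. exact Hf.
      + apply differentiable_pt_lim_affine.
      + apply differentiable_pt_lim_snd.
    - intros s t. simpl. f_equal. ring.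
    - ring.
    - ring. }
  exists (fun x y => - a (- x) y), (fun x y => b (- x) y).
  repeat split; intros x y.
  - apply D, Hu.
  - eapply differentiable_pt_lim_eq.
    + eapply (differentiable_pt_lim_lin (fun s t => v (- s) t) (fun s _ => s) x y)
        with (c := 0) (l := -1) (m := 0).
      * apply D, Hv.
      * apply differentiable_pt_lim_fst.
    + intros; simpl; ring.
    + ring.
    + ring.
  - apply continuity_2d_pt_opp, C, Ha.
  - apply C, Hb.
Qed.

(** * Mean value property and maximum principle *)

Lemma continuity_2d_circle (f : R -> R -> R) (x y : R) :
  (forall s t, continuity_2d_pt f s t) ->
  forall r t, continuity_2d_pt (fun r t => f (x + r * cos t) (y + r * sin t)) r t.
Proof.
  intros Hf r t.
  apply (continuity_2d_pt_comp2 f (fun r t => x + r * cos t) (fun r t => y + r * sin t)); auto;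
    apply continuity_2d_pt_plus; try apply continuity_2d_pt_const;
    apply continuity_2d_pt_mult; try apply continuity_2d_pt_id1.
  - apply (continuity_1d_2d_pt_comp cos (fun _ t => t)).
    + apply continuity_cos.
    + apply continuity_2d_pt_id2.
  - apply (continuity_1d_2d_pt_comp sin (fun _ t => t)).
    + apply continuity_sin.
    + apply continuity_2d_pt_id2.
Qed.

Lemma continuous_circle (f : R -> R -> R) (x y r t : R) :
  (forall s t, continuity_2d_pt f s t) ->
  continuous (fun t => f (x + r * cos t) (y + r * sin t)) t.
Proof.
  intros Hf.
  apply (continuous_of_continuity_2d (fun r t => f (x + r * cos t) (y + r * sin t))
           (fun _ => r) (fun t => t)).
  - now apply continuity_2d_circle.
  - apply continuous_const.
  - apply continuous_id.
Qed.

Lemma ex_RInt_circle (f : R -> R -> R) (x y r c d : R) :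
  (forall s t, continuity_2d_pt f s t) ->
  ex_RInt (fun t => f (x + r * cos t) (y + r * sin t)) c d.
Proof.
  intros Hf. apply (ex_RInt_continuous (V := R_CompleteNormedModule)).
  intros t _. now apply continuous_circle.
Qed.

Lemma is_RInt_primitive (g dg : R -> R) (a b l : R) :
  (forall t, is_derive g t (dg t)) -> (forall t, continuous dg t) ->
  g b - g a = l -> is_RInt dg a b l.
Proof.
  intros Hg Hc <-.
  apply (is_RInt_derive (V := R_CompleteNormedModule) g dg); auto.
Qed.

(* By the Cauchy-Riemann equations, [r] times the radial derivative of [u]
   is the angular derivative of [v], whose integral over the circle vanishes. *)
Lemma hol_mean_value (u v : R -> R -> R) (x y r : R) :
  hol u v -> 0 < r ->
  RInt (fun t => u (x + r * cos t) (y + r * sin t)) 0 (2 * PI) = 2 * PI * u x y.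
Proof.
  intros H Hr.
  pose proof (hol_continuity_l _ _ H) as Cu.
  destruct H as (a & b & Hu & Hv & Ha & Hb).
  set (D := fun r t => a (x + r * cos t) (y + r * sin t) * cos t
                       - b (x + r * cos t) (y + r * sin t) * sin t).
  set (P := fun r => RInt (fun t => u (x + r * cos t) (y + r * sin t)) 0 (2 * PI)).
  assert (DE : forall r t, is_derive (fun r => u (x + r * cos t) (y + r * sin t)) r (D r t)).
  { intros s t. apply is_derive_Reals.
    replace (D s t) with (a (x + s * cos t) (y + s * sin t) * cos t +
      (- b (x + s * cos t) (y + s * sin t)) * sin t) by (unfold D; ring).
    apply (derivable_pt_lim_comp_2d u (fun s => x + s * cos t) (fun s => y + s * sin t)).
    - apply Hu.
    - apply is_derive_Reals. auto_derive; auto. ring.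
    - apply is_derive_Reals. auto_derive; auto. ring. }
  assert (CD : forall r t, continuity_2d_pt D r t).
  { intros s t. apply continuity_2d_pt_minus; apply continuity_2d_pt_mult;
      try (now apply continuity_2d_circle).
    - apply (continuity_1d_2d_pt_comp cos (fun _ t => t)).
      + apply continuity_cos.
      + apply continuity_2d_pt_id2.
    - apply (continuity_1d_2d_pt_comp sin (fun _ t => t)).
      + apply continuity_sin.
      + apply continuity_2d_pt_id2. }
  assert (CDt : forall s t, continuous (D s) t).
  { intros s t. apply (continuous_of_continuity_2d D (fun _ => s) (fun t => t)); auto.
    - apply continuous_const.
    - apply continuous_id. }
  assert (ID : forall s, RInt (D s) 0 (2 * PI) = 0).
  { intros s. destruct (Req_dec s 0) as [-> | Hs].
    - apply is_RInt_unique.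
      apply is_RInt_primitive with (g := fun t => a x y * sin t + b x y * cos t).
      + intros t. unfold D. rewrite !Rmult_0_l, !Rplus_0_r. auto_derive; auto. ring.
      + apply CDt.
      + rewrite sin_2PI, cos_2PI, sin_0, cos_0. ring.
    - assert (E : is_RInt (fun t => scal s (D s t)) 0 (2 * PI) 0).
      { apply is_RInt_primitive with (g := fun t => v (x + s * cos t) (y + s * sin t)).
        - intros t. apply is_derive_Reals.
          replace (scal s (D s t)) with
            (b (x + s * cos t) (y + s * sin t) * (- (s * sin t)) +
             a (x + s * cos t) (y + s * sin t) * (s * cos t))
            by (unfold D, scal; simpl; unfold mult; simpl; ring).
          apply (derivable_pt_lim_comp_2d v (fun t => x + s * cos t) (fun t => y + s * sin t)).
          + apply Hv.
          + apply is_derive_Reals. auto_derive; auto. ring.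
          + apply is_derive_Reals. auto_derive; auto. ring.
        - intros t. apply (continuous_scal_r (V := R_NormedModule) s (D s)), CDt.
        - rewrite sin_2PI, cos_2PI, sin_0, cos_0. ring. }
      assert (E' : ex_RInt (D s) 0 (2 * PI)).
      { apply (ex_RInt_continuous (V := R_CompleteNormedModule)). intros; apply CDt. }
      apply (is_RInt_unique (V := R_CompleteNormedModule)) in E.
      rewrite (RInt_scal (V := R_CompleteNormedModule)) in E by exact E'.
      apply Rmult_integral in E. tauto. }
  assert (DP : forall s, is_derive P s 0).
  { intros s. rewrite <- (ID s).
    rewrite (RInt_ext (D s) (fun t => Derive (fun r => u (x + r * cos t) (y + r * sin t)) s)).
    2:{ intros t _. symmetry. apply is_derive_unique, DE. }
    apply (is_derive_RInt_param (fun r t => u (x + r * cos t) (y + r * sin t))).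
    - apply filter_forall. intros r' t _. exists (D r' t). apply DE.
    - intros t _. apply continuity_2d_pt_ext with (2 := CD s t).
      intros. symmetry. apply is_derive_unique, DE.
    - apply filter_forall. intros r'. now apply ex_RInt_circle. }
  change (P r = 2 * PI * u x y).
  (* [P] is constant, and at radius 0 the circle degenerates to its centre. *)
  rewrite <- (eq_is_derive P 0 r (fun t _ => DP t) Hr).
  unfold P. rewrite (RInt_ext _ (fun _ => u x y)).
  - rewrite RInt_const. unfold scal; simpl; unfold mult; simpl. ring.
  - intros t _. now rewrite !Rmult_0_l, !Rplus_0_r.
Qed.

(** Compactness gives a positive lower bound [e] for the radius [delta] at some point near any given
    one. Since [delta] is capped by [/ (1 + Rabs (f x y))], this lower bound turns into an upper
    bound for [f]. *)
Lemma continuity_2d_bounded (f : R -> R -> R) (a b c d : R) :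
  (forall x y, a <= x <= b -> c <= y <= d -> continuity_2d_pt f x y) ->
  exists M, forall x y, a <= x <= b -> c <= y <= d -> f x y <= M.
Proof.
  intros Hf.
  assert (H : forall x y, exists e : posreal, e <= / (1 + Rabs (f x y)) /\
    (a <= x <= b -> c <= y <= d ->
      forall s t, Rabs (s - x) < e -> Rabs (t - y) < e -> Rabs (f s t - f x y) < 1)).
  { intros x y.
    assert (P : 0 < / (1 + Rabs (f x y))).
    { apply Rinv_0_lt_compat. pose proof (Rabs_pos (f x y)). lra. }
    destruct (excluded_middle_informative (a <= x <= b /\ c <= y <= d)) as [[Hx Hy] | N].
    - destruct (Hf x y Hx Hy (mkposreal 1 Rlt_0_1)) as [e He].
      assert (Q : 0 < Rmin e (/ (1 + Rabs (f x y)))).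
      { apply Rmin_pos; auto. apply cond_pos. }
      exists (mkposreal _ Q). simpl. split.
      + apply Rmin_r.
      + intros _ _ s t Hs Ht. apply He.
        * apply Rlt_le_trans with (1 := Hs), Rmin_l.
        * apply Rlt_le_trans with (1 := Ht), Rmin_l.
    - exists (mkposreal _ P). simpl. split; [ apply Rle_refl | tauto ]. }
  set (delta := fun x y => proj1_sig (constructive_indefinite_description _ (H x y))).
  destruct (compactness_value_2d a b c d delta) as [e He].
  exists (/ e + 1). intros x y Hx Hy.
  (* The goal is made a contradiction because [compactness_value_2d] concludes under a double
     negation. *)
  apply Rnot_lt_le. intros Hlt. apply (He x y Hx Hy).
  intros (s & t & Hs & Ht & Ds & Dt & Le).
  unfold delta in Ds, Dt, Le.
  destruct (constructive_indefinite_description _ (H s t)) as [e' [H1 H2]]; simpl in *.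
  specialize (H2 Hs Ht x y Ds Dt).
  apply Rabs_def2 in H2.
  pose proof (Rabs_pos (f s t)) as P. pose proof (Rle_abs (f s t)).
  assert (1 + Rabs (f s t) <= / e).
  { rewrite <- (Rinv_inv (1 + Rabs (f s t))). apply Rinv_le_contravar.
    - apply cond_pos.
    - lra. }
  lra.
Qed.

(** If the supremum [S] were not attained, [/ (S - f)] would be continuous, hence bounded by some
    [K], and [S - / K] would be a smaller upper bound. *)
Lemma continuity_2d_max (f : R -> R -> R) (a b c d : R) :
  a <= b -> c <= d -> (forall x y, continuity_2d_pt f x y) ->
  exists x0 y0, a <= x0 <= b /\ c <= y0 <= d /\
    forall x y, a <= x <= b -> c <= y <= d -> f x y <= f x0 y0.
Proof.
  intros Hab Hcd Hf.
  destruct (continuity_2d_bounded f a b c d) as [M HM]; [ now auto |].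
  destruct (completeness (fun z => exists x y, a <= x <= b /\ c <= y <= d /\ z = f x y))
    as [S [HS1 HS2]].
  { exists M. intros z (x & y & Hx & Hy & ->). auto. }
  { exists (f a c), a, c. repeat split; lra. }
  apply NNPP. intros N.
  assert (P : forall x y, a <= x <= b -> c <= y <= d -> 0 < S - f x y).
  { intros x y Hx Hy.
    assert (f x y <= S) by (apply HS1; now exists x, y).
    destruct (Req_dec (f x y) S) as [E | E]; [| lra].
    exfalso. apply N. exists x, y. repeat split; try tauto.
    intros s t Hs Ht. rewrite E. apply HS1. now exists s, t. }
  destruct (continuity_2d_bounded (fun x y => / (S - f x y)) a b c d) as [K HK].
  { intros x y Hx Hy. apply continuity_2d_pt_inv.
    - apply continuity_2d_pt_minus; auto. apply continuity_2d_pt_const.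
    - specialize (P x y Hx Hy). lra. }
  assert (KP : 0 < K).
  { apply Rlt_le_trans with (2 := HK a c ltac:(lra) ltac:(lra)).
    apply Rinv_0_lt_compat, P; lra. }
  assert (S <= S - / K).
  { apply HS2. intros z (x & y & Hx & Hy & ->).
    specialize (P x y Hx Hy). specialize (HK x y Hx Hy).
    assert (/ K <= S - f x y).
    { rewrite <- (Rinv_inv (S - f x y)). apply Rinv_le_contravar; auto.
      now apply Rinv_0_lt_compat. }
    lra. }
  pose proof (Rinv_0_lt_compat K KP). lra.
Qed.

(** The excess [PI * r ^ 2] over [2 * PI * x ^ 2] is the strict subharmonicity of [x ^ 2]. *)
Lemma RInt_circle_fst_square (x r : R) :
  is_RInt (fun t => (x + r * cos t) ^ 2) 0 (2 * PI) (2 * PI * x ^ 2 + PI * r ^ 2).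
Proof.
  apply is_RInt_primitive
    with (g := fun t => x ^ 2 * t + 2 * x * r * sin t + r ^ 2 * ((t + sin t * cos t) / 2)).
  - intros t. auto_derive; auto.
    pose proof (sin2_cos2 t) as E. unfold Rsqr in E. nra.
  - intros t. apply (ex_derive_continuous (fun t => (x + r * cos t) ^ 2)). auto_derive; auto.
  - rewrite sin_2PI, cos_2PI, sin_0, cos_0. field.
Qed.

(* Adding [e x^2] makes the mean over a circle strictly larger than the value
   at its centre, so that the maximum is not attained in the interior. *)
Lemma hol_max_principle (u v : R -> R -> R) (a b c d B : R) :
  hol u v ->
  (forall x y, a <= x <= b -> c <= y <= d ->
     x = a \/ x = b \/ y = c \/ y = d -> u x y <= B) ->
  forall x y, a <= x <= b -> c <= y <= d -> u x y <= B.
Proof.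
  intros H HB x1 y1 Hx1 Hy1. apply Rnot_lt_le. intros Hlt.
  pose proof (hol_continuity_l _ _ H) as Cu.
  set (X := a ^ 2 + b ^ 2 + 1).
  assert (HX : 0 < X) by (unfold X; nra).
  (* The perturbation [e * x ^ 2] is at most half the excess of [u x1 y1] over [B], so [w] on the
     boundary stays below [w x1 y1]. *)
  set (e := (u x1 y1 - B) / (2 * X)).
  assert (He : 0 < e) by (apply Rdiv_lt_0_compat; lra).
  assert (HeX : e * X = (u x1 y1 - B) / 2) by (unfold e; field; lra).
  assert (sqX : forall x, a <= x <= b -> x ^ 2 <= X).
  { intros x Hx. unfold X. destruct (Rle_dec 0 x); nra. }
  set (w := fun x y => u x y + e * x ^ 2).
  assert (Cw : forall x y, continuity_2d_pt w x y).
  { intros x y. apply continuity_2d_pt_plus; auto. apply continuity_2d_pt_mult.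
    - apply continuity_2d_pt_const.
    - apply (continuity_1d_2d_pt_comp (fun s => s ^ 2) (fun s _ => s)).
      + apply derivable_continuous_pt, derivable_pt_pow.
      + apply continuity_2d_pt_id1. }
  destruct (continuity_2d_max w a b c d) as (x0 & y0 & Hx0 & Hy0 & Hm); auto; try lra.
  assert (W1 := Hm x1 y1 Hx1 Hy1).
  assert (I0 : B + e * X < w x0 y0).
  { apply Rlt_le_trans with (2 := W1). unfold w. nra. }
  assert (Int : a < x0 < b /\ c < y0 < d).
  { assert (N : ~ (x0 = a \/ x0 = b \/ y0 = c \/ y0 = d)).
    { intros N. specialize (HB x0 y0 Hx0 Hy0 N). unfold w in I0.
      specialize (sqX x0 Hx0). nra. }
    lra. }
  destruct Int as [Ix Iy].
  (* The distance to the boundary: the whole circle stays in the rectangle. *)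
  set (r := Rmin (Rmin (x0 - a) (b - x0)) (Rmin (y0 - c) (d - y0))).
  assert (Hr : 0 < r) by (repeat apply Rmin_pos; lra).
  assert (r <= x0 - a /\ r <= b - x0 /\ r <= y0 - c /\ r <= d - y0).
  { unfold r. repeat split.
    - eapply Rle_trans; apply Rmin_l.
    - eapply Rle_trans; [ apply Rmin_l | apply Rmin_r ].
    - eapply Rle_trans; [ apply Rmin_r | apply Rmin_l ].
    - eapply Rle_trans; apply Rmin_r. }
  pose proof PI_RGT_0 as HPI.
  assert (E : RInt (fun t => w (x0 + r * cos t) (y0 + r * sin t)) 0 (2 * PI)
              = 2 * PI * u x0 y0 + e * (2 * PI * x0 ^ 2 + PI * r ^ 2)).
  { rewrite <- (hol_mean_value u v x0 y0 r H Hr).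
    apply is_RInt_unique.
    apply (is_RInt_plus (V := R_NormedModule)).
    - apply (RInt_correct (V := R_CompleteNormedModule)), ex_RInt_circle, Cu.
    - apply (is_RInt_scal (V := R_NormedModule)), RInt_circle_fst_square. }
  assert (L : RInt (fun t => w (x0 + r * cos t) (y0 + r * sin t)) 0 (2 * PI)
              <= RInt (fun _ => w x0 y0) 0 (2 * PI)).
  { apply RInt_le.
    - lra.
    - apply ex_RInt_circle, Cw.
    - apply ex_RInt_const.
    - intros t _. pose proof (COS_bound t). pose proof (SIN_bound t).
      apply Hm; nra. }
  rewrite E, RInt_const in L. unfold scal in L; simpl in L; unfold mult in L; simpl in L.
  unfold w in L.
  assert (0 < e * (PI * r ^ 2)).
  { apply Rmult_lt_0_compat; auto. apply Rmult_lt_0_compat; auto. now apply pow_lt. }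
  nra.
Qed.

(** The maximum principle is applied to the real part of [conj (F z0) * F]. It equals [|F z0|^2] at
    [z0], and on the boundary it is at most [(|F z0|^2 + K) / 2]. *)
Lemma hol_max_modulus (u v : R -> R -> R) (a b c d K : R) :
  hol u v ->
  (forall x y, a <= x <= b -> c <= y <= d ->
     x = a \/ x = b \/ y = c \/ y = d -> u x y ^ 2 + v x y ^ 2 <= K) ->
  forall x y, a <= x <= b -> c <= y <= d -> u x y ^ 2 + v x y ^ 2 <= K.
Proof.
  intros H HK x0 y0 Hx0 Hy0.
  set (p := u x0 y0). set (q := v x0 y0).
  assert (p * u x0 y0 + q * v x0 y0 <= (p ^ 2 + q ^ 2 + K) / 2).
  { apply (hol_max_principle (fun x y => p * u x y + q * v x y)
             (fun x y => p * v x y - q * u x y) a b c d); auto.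
    - refine (hol_ext _ _ _ _ _ _ (hol_comp _ _ _ _ (hol_affine 0 0 p (- q)) H));
        intros; simpl; ring.
    - intros x y Hx Hy Hb. specialize (HK x y Hx Hy Hb).
      pose proof (pow2_ge_0 (p - u x y)). pose proof (pow2_ge_0 (q - v x y)). nra. }
  fold p q in H0 |- *. nra.
Qed.

(** * Phragmen-Lindelof *)

(** With [G = p + i q], the product [F exp G] is entire and its squared modulus carries the factor
    [exp (2 p)]. *)
Lemma hol_max_modulus_weighted (u v p q : R -> R -> R) (a b c d K : R) :
  hol u v -> hol p q ->
  (forall x y, a <= x <= b -> c <= y <= d ->
     x = a \/ x = b \/ y = c \/ y = d ->
     (u x y ^ 2 + v x y ^ 2) * exp (2 * p x y) <= K) ->
  forall x y, a <= x <= b -> c <= y <= d ->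
    (u x y ^ 2 + v x y ^ 2) * exp (2 * p x y) <= K.
Proof.
  intros H Hp HK.
  assert (E : forall x y,
    (u x y * (exp (p x y) * cos (q x y)) - v x y * (exp (p x y) * sin (q x y))) ^ 2 +
    (u x y * (exp (p x y) * sin (q x y)) + v x y * (exp (p x y) * cos (q x y))) ^ 2 =
    (u x y ^ 2 + v x y ^ 2) * exp (2 * p x y)).
  { intros x y. replace (2 * p x y) with (p x y + p x y) by ring. rewrite exp_plus.
    pose proof (sin2_cos2 (q x y)) as S. unfold Rsqr in S.
    transitivity ((u x y ^ 2 + v x y ^ 2) * (exp (p x y) * exp (p x y)) *
      (sin (q x y) * sin (q x y) + cos (q x y) * cos (q x y))); [ ring | rewrite S; ring ]. }
  pose proof (hol_max_modulus _ _ a b c d K (hol_mult _ _ _ _ H (hol_comp _ _ _ _ hol_exp Hp))) as M.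
  cbv beta in M. intros x y Hx Hy. rewrite <- E. apply M; auto.
  intros s t Hs Ht Hb. rewrite E. now apply HK.
Qed.

(** As [eps] is arbitrary, neither the square of the modulus nor the use of [Rabs x + Rabs y] for
    the norm changes the notion. *)
Definition type_zero (u v : R -> R -> R) : Prop :=
  forall eps, 0 < eps -> exists C, forall x y,
    u x y ^ 2 + v x y ^ 2 <= C * exp (eps * (Rabs x + Rabs y)).

Lemma exp_decay (eta C S : R) : 0 < eta -> 0 < S ->
  exists X0, 0 <= X0 /\ forall X, X0 <= X -> C * exp (- (eta * X)) <= S.
Proof.
  (* From [exp t >= 1 + t]: beyond this point [S * exp (eta * X)] exceeds [Rabs C]. *)
  intros He HS. exists (Rabs C / (S * eta)).
  assert (P : 0 < S * eta) by nra. split.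
  { apply Rmult_le_pos; [ apply Rabs_pos | now apply Rlt_le, Rinv_0_lt_compat ]. }
  intros X HX.
  assert (L : Rabs C <= S * (eta * X)).
  { replace (Rabs C) with (Rabs C / (S * eta) * (S * eta)) by (field; lra). nra. }
  pose proof (exp_ineq1_le (eta * X)). pose proof (Rle_abs C).
  pose proof (exp_pos (- (eta * X))).
  replace S with (S * exp (eta * X) * exp (- (eta * X))).
  - apply Rmult_le_compat_r; nra.
  - rewrite Rmult_assoc, <- exp_plus. replace (eta * X + - (eta * X)) with 0 by ring.
    rewrite exp_0. ring.
Qed.

(** Stands for the limit [d -> 0] at a fixed point; it removes the parameters of the weights. *)
Lemma le_of_le_mul_exp (A S x : R) :
  0 < S -> (forall d, 0 < d -> A <= S * exp (d * x)) -> A <= S.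
Proof.
  intros HS H. apply Rnot_lt_le. intros Hlt.
  set (y := Rabs x + 1).
  assert (Hy : 0 < y) by (unfold y; pose proof (Rabs_pos x); lra).
  assert (Hl : 0 < ln (A / S)).
  { rewrite <- ln_1. apply ln_increasing; [ lra |].
    apply Rmult_lt_reg_r with S; auto. field_simplify; lra. }
  set (d := ln (A / S) / (2 * y)).
  assert (Hd : 0 < d) by (apply Rdiv_lt_0_compat; lra).
  specialize (H d Hd).
  assert (L : exp (d * x) < exp (ln (A / S))).
  { apply exp_increasing. apply Rle_lt_trans with (d * y).
    - apply Rmult_le_compat_l; [ lra |]. unfold y. pose proof (Rle_abs x). lra.
    - unfold d. field_simplify; lra. }
  rewrite exp_ln in L by (apply Rdiv_lt_0_compat; lra).
  apply (Rmult_lt_compat_l S) in L; auto.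
  replace (S * (A / S)) with A in L by (field; lra). lra.
Qed.

Lemma exp_le_1 (x : R) : x <= 0 -> exp x <= 1.
Proof. intros [H | ->]; [ rewrite <- exp_0; now apply Rlt_le, exp_increasing | rewrite exp_0; lra ]. Qed.

Lemma exp_le_exp (x y : R) : x <= y -> exp x <= exp y.
Proof. intros [H | ->]; [ now apply Rlt_le, exp_increasing | lra ]. Qed.

Lemma mul_exp_opp_le (A S x : R) : A * exp (- x) <= S -> A <= S * exp x.
Proof.
  intros H. apply (Rmult_le_compat_r (exp x)) in H; [| apply Rlt_le, exp_pos ].
  now rewrite Rmult_assoc, <- exp_plus, Rplus_opp_l, exp_0, Rmult_1_r in H.
Qed.

(* The weight is [exp (i e z / 2 - d z / 2)]: its factor [exp (- e y / 2)] bounds the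
   function on the imaginary axis, and the other one makes it decay along the real axis. *)
Lemma quadrant_bound (u v : R -> R -> R) (K e : R) :
  hol u v -> type_zero u v -> 0 < e ->
  (forall x, u x 0 ^ 2 + v x 0 ^ 2 <= K) ->
  exists S, 0 < S /\ forall x y, 0 <= x -> 0 <= y ->
    u x y ^ 2 + v x y ^ 2 <= S * exp (e * y).
Proof.
  intros H HT He HK.
  destruct (HT e He) as [C HC].
  set (S := Rabs K + Rabs C + 1).
  assert (SK : K <= S) by (unfold S; pose proof (Rle_abs K); pose proof (Rabs_pos C); lra).
  assert (SC : C <= S) by (unfold S; pose proof (Rle_abs C); pose proof (Rabs_pos K); lra).
  assert (SP : 0 < S) by (unfold S; pose proof (Rabs_pos C); pose proof (Rabs_pos K); lra).
  exists S. split; auto. intros x y Hx Hy.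
  apply mul_exp_opp_le, (le_of_le_mul_exp _ _ x SP). intros d Hd.
  apply mul_exp_opp_le. rewrite Rmult_assoc, <- exp_plus.
  (* Growth with this exponent, times the weight [exp (- d s - e t)], still leaves a decay
     [exp (- eta (s + t))]. *)
  set (eta := Rmin e d / 2).
  pose proof (Rmin_l e d). pose proof (Rmin_r e d).
  assert (Hm : 0 < Rmin e d) by (apply Rmin_pos; auto).
  assert (Heta : 0 < eta) by (unfold eta; lra).
  destruct (HT eta Heta) as [C' HC'].
  destruct (exp_decay eta (Rabs C') S Heta SP) as (X0 & HX0 & HX).
  (* The square of side [X] contains the point, and its two far sides satisfy [X <= s + t], where
     the decay gives [S]. *)
  set (X := X0 + x + y).
  specialize (HX X ltac:(unfold X; lra)).
  assert (Hfar : forall s t, 0 <= s -> 0 <= t -> X <= s + t ->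
    (u s t ^ 2 + v s t ^ 2) * exp (2 * (0 + - (d / 2) * s - e / 2 * t)) <= S).
  { intros s t Hs Ht Hst. apply Rle_trans with (2 := HX).
    apply Rle_trans with (Rabs C' * exp (eta * (Rabs s + Rabs t)) *
      exp (2 * (0 + - (d / 2) * s - e / 2 * t))).
    - apply Rmult_le_compat_r; [ apply Rlt_le, exp_pos |].
      apply Rle_trans with (1 := HC' s t). apply Rmult_le_compat_r; [ apply Rlt_le, exp_pos |].
      apply Rle_abs.
    - rewrite Rmult_assoc, <- exp_plus. apply Rmult_le_compat_l; [ apply Rabs_pos |].
      apply exp_le_exp. rewrite !Rabs_pos_eq by auto. unfold eta in *. nra. }
  pose proof (hol_max_modulus_weighted u v _ _ 0 X 0 X S H (hol_affine 0 0 (- (d / 2)) (e / 2))) as M.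
  cbv beta in M.
  replace (- (e * y) + - (d * x)) with (2 * (0 + - (d / 2) * x - e / 2 * y)) by field.
  apply M; try (unfold X; lra).
  intros s t Hs Ht Hb.
  assert (N0 : 0 <= u s t ^ 2 + v s t ^ 2) by nra.
  destruct Hb as [-> | [-> | [-> | ->]]]; try (apply Hfar; lra).
  - apply Rle_trans with (C * exp (e * (Rabs 0 + Rabs t)) *
      exp (2 * (0 + - (d / 2) * 0 - e / 2 * t))).
    + apply Rmult_le_compat_r; [ apply Rlt_le, exp_pos | apply HC ].
    + rewrite Rmult_assoc, <- exp_plus, Rabs_R0, (Rabs_pos_eq t) by lra.
      replace (e * (0 + t) + _) with 0 by field. rewrite exp_0. lra.
  - apply Rle_trans with (u s 0 ^ 2 + v s 0 ^ 2).
    + rewrite <- Rmult_1_r. apply Rmult_le_compat_l; auto. apply exp_le_1. nra.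
    + apply Rle_trans with (2 := SK), HK.
Qed.

Lemma type_zero_reflect (u v : R -> R -> R) :
  type_zero u v -> type_zero (fun x y => u (- x) y) (fun x y => - v (- x) y).
Proof.
  intros H e He. destruct (H e He) as [C HC]. exists C. intros x y.
  specialize (HC (- x) y). rewrite Rabs_Ropp in HC. nra.
Qed.

Lemma half_plane_growth (u v : R -> R -> R) (K e : R) :
  hol u v -> type_zero u v -> 0 < e ->
  (forall x, u x 0 ^ 2 + v x 0 ^ 2 <= K) ->
  exists S, 0 < S /\ forall x y, 0 <= y ->
    u x y ^ 2 + v x y ^ 2 <= S * exp (e * y).
Proof.
  intros H HT He HK.
  destruct (quadrant_bound u v K e) as (S1 & P1 & H1); auto.
  destruct (quadrant_bound (fun x y => u (- x) y) (fun x y => - v (- x) y) K e)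
    as (S2 & P2 & H2); auto.
  - now apply hol_reflect.
  - now apply type_zero_reflect.
  - intros x. specialize (HK (- x)). nra.
  - exists (S1 + S2). split; [ lra |]. intros x y Hy.
    pose proof (exp_pos (e * y)).
    destruct (Rle_dec 0 x) as [Hx | Hx].
    + specialize (H1 x y Hx Hy). nra.
    + specialize (H2 (- x) y ltac:(lra) Hy). rewrite Ropp_involutive in H2. nra.
Qed.

(* The weight is [exp (i e z / 2 - d z^2 / 2)], on a strip so high that the growth bound
   with exponent [e / 2] already gives [K] on its upper side. *)
Lemma half_plane_bound (u v : R -> R -> R) (K : R) :
  hol u v -> type_zero u v -> 0 < K ->
  (forall x, u x 0 ^ 2 + v x 0 ^ 2 <= K) ->
  forall x y, 0 <= y -> u x y ^ 2 + v x y ^ 2 <= K.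
Proof.
  intros H HT KP HK x y Hy.
  apply (le_of_le_mul_exp _ _ y KP). intros e He.
  (* Half of [e], so that the weight [exp (- e y)] wins on the upper side of the strip. *)
  destruct (half_plane_growth u v K (e / 2)) as (S & SP & HS); auto; [ lra |].
  destruct (exp_decay (e / 2) S K) as (Y0 & HY0 & HY); auto; [ lra |].
  set (Y := Y0 + y). specialize (HY Y ltac:(unfold Y; lra)).
  assert (YP : 0 <= Y) by (unfold Y; lra).
  (* The strip is unbounded on both sides, hence a quadratic exponent. On the strip
     [exp (- d z^2 / 2)] costs at most [exp (d Y^2)] in squared modulus, which disappears with [d]
     since [Y] depends only on [e] and the point. *)
  apply mul_exp_opp_le, (le_of_le_mul_exp _ _ (x ^ 2 + Y ^ 2) KP). intros d Hd.
  apply mul_exp_opp_le. rewrite Rmult_assoc, <- exp_plus.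
  destruct (exp_decay d (S * exp (e / 2 * Y)) K) as (X0 & HX0 & HX); auto.
  (* The final 1 gives [X <= X ^ 2], so that the decay in [d * X] suffices. *)
  set (X := X0 + Rabs x + 1).
  specialize (HX X ltac:(unfold X; pose proof (Rabs_pos x); lra)).
  assert (X1 : 1 <= X) by (unfold X; pose proof (Rabs_pos x); lra).
  assert (Xx : - X <= x <= X).
  { unfold X. assert (Rabs x <= X0 + Rabs x + 1) as L by lra.
    apply Rabs_le_between in L. exact L. }
  pose proof (hol_max_modulus_weighted u v _ _ (- X) X 0 Y (K * exp (d * Y ^ 2)) H
    (hol_mult _ _ _ _ (hol_affine 0 0 1 0) (hol_affine 0 (e / 2) (- (d / 2)) 0))) as M.
  cbv beta in M.
  assert (W : forall s t, 2 * ((0 + 1 * s - 0 * t) * (0 + - (d / 2) * s - 0 * t) -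
        (0 + 0 * s + 1 * t) * (e / 2 + 0 * s + - (d / 2) * t)) =
        - (e * t) + - (d * s ^ 2) + d * t ^ 2) by (intros; field).
  specialize (fun P => M P x y Xx ltac:(unfold Y; lra)).
  rewrite W in M.
  replace (- (e * y) + - (d * (x ^ 2 + Y ^ 2))) with
    ((- (e * y) + - (d * x ^ 2) + d * y ^ 2) + (- (d * y ^ 2) + - (d * Y ^ 2))) by ring.
  rewrite exp_plus, <- Rmult_assoc.
  set (N := (u x y ^ 2 + v x y ^ 2) * exp (- (e * y) + - (d * x ^ 2) + d * y ^ 2)) in *.
  assert (MM : N <= K * exp (d * Y ^ 2)).
  { apply M. clear M N. intros s t Hs Ht Hb. rewrite W.
    assert (N0 : 0 <= u s t ^ 2 + v s t ^ 2) by nra.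
    assert (T2 : t ^ 2 <= Y ^ 2) by nra.
    assert (D2 : d * t ^ 2 <= d * Y ^ 2) by nra.
    assert (S2 : 0 <= d * s ^ 2) by nra.
    assert (Low : t = 0 -> (u s t ^ 2 + v s t ^ 2) * exp (- (e * t) + - (d * s ^ 2) + d * t ^ 2)
              <= K * exp (d * Y ^ 2)).
    { intros ->. apply Rmult_le_compat; auto; [ apply Rlt_le, exp_pos |].
      apply exp_le_exp. nra. }
    assert (G := HS s t ltac:(lra)).
    assert (E : (u s t ^ 2 + v s t ^ 2) * exp (- (e * t) + - (d * s ^ 2) + d * t ^ 2) <=
      S * exp (- (e / 2 * t) + - (d * s ^ 2)) * exp (d * Y ^ 2)).
    { apply Rle_trans with (S * exp (e / 2 * t) * exp (- (e * t) + - (d * s ^ 2) + d * t ^ 2)).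
      - apply Rmult_le_compat_r; [ apply Rlt_le, exp_pos | auto ].
      - rewrite !Rmult_assoc, <- !exp_plus. apply Rmult_le_compat_l; [ lra |].
        apply exp_le_exp. lra. }
    destruct Hb as [Hb | [Hb | [Hb | Hb]]]; auto; apply Rle_trans with (1 := E);
      apply Rmult_le_compat_r; try (apply Rlt_le, exp_pos).
    - apply Rle_trans with (2 := HX). rewrite Rmult_assoc, <- exp_plus.
      apply Rmult_le_compat_l; [ lra |]. apply exp_le_exp. subst s.
      assert (0 <= e / 2 * t) by nra. assert (0 <= e / 2 * Y) by nra.
      assert (d * X <= d * X ^ 2) by (apply Rmult_le_compat_l; nra). nra.
    - apply Rle_trans with (2 := HX). rewrite Rmult_assoc, <- exp_plus.
      apply Rmult_le_compat_l; [ lra |]. apply exp_le_exp. subst s.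
      assert (0 <= e / 2 * t) by nra. assert (0 <= e / 2 * Y) by nra.
      assert (d * X <= d * X ^ 2) by (apply Rmult_le_compat_l; nra). nra.
    - apply Rle_trans with (2 := HY).
      apply Rmult_le_compat_l; [ lra |]. apply exp_le_exp. subst t. lra. }
  apply Rle_trans with (K * exp (d * Y ^ 2) * exp (- (d * y ^ 2) + - (d * Y ^ 2))).
  - apply Rmult_le_compat_r; [ apply Rlt_le, exp_pos | auto ].
  - rewrite Rmult_assoc, <- exp_plus. rewrite <- Rmult_1_r.
    apply Rmult_le_compat_l; [ lra |]. apply exp_le_1. nra.
Qed.

Lemma phragmen_lindelof (u v : R -> R -> R) (K : R) :
  hol u v -> type_zero u v -> 0 < K ->
  (forall x, u x 0 ^ 2 + v x 0 ^ 2 <= K) ->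
  forall x y, u x y ^ 2 + v x y ^ 2 <= K.
Proof.
  intros H HT KP HK x y.
  destruct (Rle_dec 0 y) as [Hy | Hy]; [ now apply half_plane_bound |].
  assert (A : forall s t, 0 + -1 * s - 0 * t = - s) by (intros; ring).
  assert (B : forall s t, 0 + 0 * s + -1 * t = - t) by (intros; ring).
  pose proof (half_plane_bound (fun s t => u (- s) (- t)) (fun s t => v (- s) (- t)) K) as P.
  specialize (fun H1 H2 H3 H4 => P H1 H2 H3 H4 (- x) (- y) ltac:(lra)).
  cbv beta in P. rewrite !Ropp_involutive in P. apply P; auto.
  - refine (hol_ext _ _ _ _ _ _ (hol_comp _ _ _ _ H (hol_affine 0 0 (-1) 0)));
      intros; simpl; now rewrite A, B.
  - intros e He. destruct (HT e He) as [C HC]. exists C. intros s t.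
    specialize (HC (- s) (- t)). now rewrite !Rabs_Ropp in HC.
  - intros s. rewrite Ropp_0. apply HK.
Qed.

(** * Constancy *)

(** Solves [rho exp (i (s + i t)) = x + i y]; for [0 < x] the argument is simply [atan (y / x)]. *)
Lemma polar_right_half_plane (x y rho : R) : 0 < x -> 0 < rho ->
  exists s t, rho * (exp (- t) * cos s) = x /\ rho * (exp (- t) * sin s) = y.
Proof.
  intros Hx Hr. set (s := atan (y / x)).
  assert (Hc : 0 < cos s).
  { destruct (atan_bound (y / x)). apply cos_gt_0; unfold s; lra. }
  assert (Hs : sin s = y / x * cos s).
  { pose proof (tan_atan (y / x)) as E. fold s in E. unfold tan in E.
    rewrite <- E. field. lra. }
  exists s, (- ln (x / (rho * cos s))).
  rewrite Ropp_involutive, exp_ln.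
  - rewrite Hs. split; field; lra.
  - apply Rdiv_lt_0_compat; nra.
Qed.

(* For a bounded entire [F], the entire function [F (c + rho exp (i z)) - F c] is small on
   the real axis when [rho] is small, hence everywhere by Phragmen-Lindelof; its argument
   sweeps the whole plane but [c]. *)
Lemma hol_bounded_right (u v : R -> R -> R) (K : R) :
  hol u v -> (forall x y, u x y ^ 2 + v x y ^ 2 <= K) ->
  forall c1 c2 x y, 0 < x -> u (c1 + x) (c2 + y) = u c1 c2.
Proof.
  intros H HK c1 c2 x y Hx.
  enough (E : forall eta, 0 < eta -> (u (c1 + x) (c2 + y) - u c1 c2) ^ 2 <= eta).
  { apply NNPP. intros N.
    assert (P : 0 < (u (c1 + x) (c2 + y) - u c1 c2) ^ 2) by (apply pow2_gt_0; lra).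
    specialize (E ((u (c1 + x) (c2 + y) - u c1 c2) ^ 2 / 2) ltac:(lra)). lra. }
  intros eta Heta.
  (* Differences below [k] have squares at most [k ^ 2 <= k <= eta / 2], and there are two of
     them. *)
  set (k := Rmin 1 (eta / 2)).
  assert (k1 : k <= 1) by apply Rmin_l.
  assert (k2 : k <= eta / 2) by apply Rmin_r.
  assert (Hk : 0 < k) by (apply Rmin_pos; lra).
  destruct (hol_continuity_l _ _ H c1 c2 (mkposreal k Hk)) as [d1 Hd1].
  destruct (hol_continuity_r _ _ H c1 c2 (mkposreal k Hk)) as [d2 Hd2].
  simpl in Hd1, Hd2.
  set (d := Rmin d1 d2).
  assert (Hd : 0 < d) by (apply Rmin_pos; apply cond_pos).
  assert (dd1 : d <= d1) by apply Rmin_l.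
  assert (dd2 : d <= d2) by apply Rmin_r.
  destruct (polar_right_half_plane x y (d / 2)) as (s & t & <- & <-); auto; [ lra |].
  set (p := fun s t => c1 + d / 2 * (exp (- t) * cos s)).
  set (q := fun s t => c2 + d / 2 * (exp (- t) * sin s)).
  assert (Hpq : hol p q).
  { assert (A1 : forall s t, 0 + 0 * s - 1 * t = - t) by (intros; ring).
    assert (A2 : forall s t, 0 + 1 * s + 0 * t = s) by (intros; ring).
    refine (hol_ext _ _ _ _ _ _ (hol_comp _ _ _ _ (hol_affine c1 c2 (d / 2) 0)
             (hol_comp _ _ _ _ hol_exp (hol_affine 0 0 0 1))));
      intros; simpl; unfold p, q; rewrite A1, A2; ring. }
  assert (P : forall s t, (u (p s t) (q s t) - u c1 c2) ^ 2 +
                          (v (p s t) (q s t) - v c1 c2) ^ 2 <= eta).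
  { apply (phragmen_lindelof (fun s t => u (p s t) (q s t) - u c1 c2)
                             (fun s t => v (p s t) (q s t) - v c1 c2)); auto.
    - refine (hol_ext _ _ _ _ _ _ (hol_comp _ _ _ _ (hol_affine (- u c1 c2) (- v c1 c2) 1 0)
        (hol_comp _ _ _ _ H Hpq))); intros; simpl; ring.
    (* From [|F - F c|^2 <= 2 |F|^2 + 2 |F c|^2]. *)
    - intros e He. exists (4 * K). intros s' t'.
      assert (K0 := HK c1 c2). assert (K1 := HK (p s' t') (q s' t')).
      assert (E1 : 1 <= exp (e * (Rabs s' + Rabs t'))).
      { rewrite <- exp_0. apply exp_le_exp.
        pose proof (Rabs_pos s'). pose proof (Rabs_pos t'). nra. }
      apply Rle_trans with (4 * K); [| nra].
      pose proof (pow2_ge_0 (u (p s' t') (q s' t') + u c1 c2)).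
      pose proof (pow2_ge_0 (v (p s' t') (q s' t') + v c1 c2)). nra.
    - intros s'.
      pose proof (COS_bound s') as BC. pose proof (SIN_bound s') as BS.
      assert (Hp : Rabs (p s' 0 - c1) < d).
      { unfold p. rewrite Ropp_0, exp_0. apply Rabs_def1; nra. }
      assert (Hq : Rabs (q s' 0 - c2) < d).
      { unfold q. rewrite Ropp_0, exp_0. apply Rabs_def1; nra. }
      specialize (Hd1 _ _ (Rlt_le_trans _ _ _ Hp dd1) (Rlt_le_trans _ _ _ Hq dd1)).
      specialize (Hd2 _ _ (Rlt_le_trans _ _ _ Hp dd2) (Rlt_le_trans _ _ _ Hq dd2)).
      apply Rabs_def2 in Hd1. apply Rabs_def2 in Hd2.
      assert ((u (p s' 0) (q s' 0) - u c1 c2) ^ 2 <= k) by nra.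
      assert ((v (p s' 0) (q s' 0) - v c1 c2) ^ 2 <= k) by nra.
      lra. }
  specialize (P s t). unfold p, q in P.
  pose proof (pow2_ge_0 (v (c1 + d / 2 * (exp (- t) * cos s)) (c2 + d / 2 * (exp (- t) * sin s)) - v c1 c2)).
  lra.
Qed.

Lemma hol_bounded_constant (u v : R -> R -> R) (K : R) :
  hol u v -> (forall x y, u x y ^ 2 + v x y ^ 2 <= K) ->
  forall x y, u x y = u 0 0.
Proof.
  intros H HK x y.
  (* A centre to the left of both points, since [hol_bounded_right] reaches only points to the right
     of the centre. *)
  set (c := Rmin x 0 - 1).
  assert (c < x) by (unfold c; pose proof (Rmin_l x 0); lra).
  assert (c < 0) by (unfold c; pose proof (Rmin_r x 0); lra).
  transitivity (u c 0).
  - rewrite <- (hol_bounded_right u v K H HK c 0 (x - c) y) by lra. f_equal; ring.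
  - rewrite <- (hol_bounded_right u v K H HK c 0 (0 - c) 0) by lra. f_equal; ring.
Qed.

Lemma type_zero_affine (u v : R -> R -> R) (a1 a2 b1 b2 : R) :
  type_zero u v ->
  type_zero (fun x y => u (a1 + b1 * x - b2 * y) (a2 + b2 * x + b1 * y))
            (fun x y => v (a1 + b1 * x - b2 * y) (a2 + b2 * x + b1 * y)).
Proof.
  intros H e He.
  (* The linear part expands [Rabs x + Rabs y] at most [B] times; the 1 makes [B] positive. *)
  set (B := Rabs b1 + Rabs b2 + 1).
  assert (HB : 0 < B) by (unfold B; pose proof (Rabs_pos b1); pose proof (Rabs_pos b2); lra).
  destruct (H (e / B)) as [C HC]; [ now apply Rdiv_lt_0_compat |].
  exists (Rabs C * exp (e / B * (Rabs a1 + Rabs a2))). intros x y.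
  apply Rle_trans with (1 := HC _ _).
  rewrite Rmult_assoc, <- exp_plus.
  apply Rmult_le_compat; try apply Rle_abs.
  2:{ apply Rlt_le, exp_pos. }
  2:{ apply exp_le_exp.
      replace (e * (Rabs x + Rabs y)) with (e / B * (B * (Rabs x + Rabs y))) by (field; lra).
      rewrite <- Rmult_plus_distr_l. apply Rmult_le_compat_l.
      - apply Rlt_le, Rdiv_lt_0_compat; auto.
      - assert (T1 : Rabs (a1 + b1 * x - b2 * y) <= Rabs a1 + Rabs b1 * Rabs x + Rabs b2 * Rabs y).
        { rewrite <- !Rabs_mult. unfold Rminus. eapply Rle_trans; [ apply Rabs_triang |].
          rewrite Rabs_Ropp. apply Rplus_le_compat_r, Rabs_triang. }
        assert (T2 : Rabs (a2 + b2 * x + b1 * y) <= Rabs a2 + Rabs b2 * Rabs x + Rabs b1 * Rabs y).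
        { rewrite <- !Rabs_mult. eapply Rle_trans; [ apply Rabs_triang |].
          apply Rplus_le_compat_r, Rabs_triang. }
        pose proof (Rabs_pos x). pose proof (Rabs_pos y). unfold B. nra. }
  (* The remaining goal is [0 <= C], read off from the growth bound at the origin. *)
  assert (N0 : 0 <= C * exp (e / B * (Rabs 0 + Rabs 0))).
  { apply Rle_trans with (2 := HC 0 0). nra. }
  pose proof (exp_pos (e / B * (Rabs 0 + Rabs 0))).
  apply Rnot_lt_le. intros N. nra.
Qed.

Lemma hol_constant_of_bounded_line (u v : R -> R -> R) (a1 a2 b1 b2 M : R) :
  hol u v -> type_zero u v -> b1 <> 0 \/ b2 <> 0 ->
  (forall t, u (a1 + t * b1) (a2 + t * b2) ^ 2 + v (a1 + t * b1) (a2 + t * b2) ^ 2 <= M) ->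
  forall x y, u x y = u 0 0.
Proof.
  intros H HT Hb HM.
  assert (Nb : 0 < b1 ^ 2 + b2 ^ 2).
  { destruct Hb as [Hb | Hb]; pose proof (pow2_gt_0 _ Hb);
      pose proof (pow2_ge_0 b1); pose proof (pow2_ge_0 b2); lra. }
  apply (hol_bounded_constant u v (Rabs M + 1)); auto. intros x y.
  pose proof (phragmen_lindelof _ _ (Rabs M + 1)
    (hol_comp _ _ _ _ H (hol_affine a1 a2 b1 b2)) (type_zero_affine u v a1 a2 b1 b2 HT)) as P.
  pose proof (Rabs_pos M). pose proof (Rle_abs M).
  specialize (P ltac:(lra)). cbv beta in P.
  (* The preimage of [x + i y] under the affine map: [conj b (z - a) / |b|^2]. *)
  specialize (fun H => P H ((b1 * (x - a1) + b2 * (y - a2)) / (b1 ^ 2 + b2 ^ 2))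
                         ((b1 * (y - a2) - b2 * (x - a1)) / (b1 ^ 2 + b2 ^ 2))).
  match type of P with _ -> u ?X ?Y ^ 2 + _ <= _ =>
    replace X with x in P by (field; lra); replace Y with y in P by (field; lra) end.
  apply P. intros t. specialize (HM t).
  replace (a1 + b1 * t - b2 * 0) with (a1 + t * b1) by ring.
  replace (a2 + b2 * t + b1 * 0) with (a2 + t * b2) by ring. lra.
Qed.

(** * Slices *)

Lemma qnorm_ge_0 (q : quat) : 0 <= qnorm q.
Proof. apply sqrt_pos. Qed.

Lemma qnorm_sqr (q : quat) : qnorm q ^ 2 = q0 q ^ 2 + q1 q ^ 2 + q2 q ^ 2 + q3 q ^ 2.
Proof. unfold qnorm. apply pow2_sqrt. nra. Qed.

Lemma qnorm_slice_pt (J : quat) (x y : R) :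
  in_S J -> qnorm (slice_pt J x y) = sqrt (x ^ 2 + y ^ 2).
Proof.
  intros [H0 H1]. unfold qnorm, slice_pt; simpl. f_equal. rewrite H0.
  transitivity (x ^ 2 + y ^ 2 * (q1 J ^ 2 + q2 J ^ 2 + q3 J ^ 2)); [ ring | rewrite H1; ring ].
Qed.

Lemma qnorm_qmul_S (J p : quat) : in_S J -> qnorm (qmul J p) = qnorm p.
Proof.
  intros [H0 H1]. unfold qnorm, qmul; simpl. f_equal. rewrite H0.
  transitivity ((q1 J ^ 2 + q2 J ^ 2 + q3 J ^ 2) * (q0 p ^ 2 + q1 p ^ 2 + q2 p ^ 2 + q3 p ^ 2));
    [ ring | rewrite H1; ring ].
Qed.

Definition is_coord (c : quat -> R) : Prop := c = q0 \/ c = q1 \/ c = q2 \/ c = q3.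

Lemma coord_le_qnorm (c : quat -> R) (q : quat) : is_coord c -> c q ^ 2 <= qnorm q ^ 2.
Proof. rewrite qnorm_sqr. intros [-> | [-> | [-> | ->]]]; nra. Qed.

Lemma coord_qadd (c : quat -> R) (p q : quat) : is_coord c -> c (qadd p q) = c p + c q.
Proof. now intros [-> | [-> | [-> | ->]]]. Qed.

Lemma coord_qscal (c : quat -> R) (t : R) (q : quat) : is_coord c -> c (qscal t q) = t * c q.
Proof. now intros [-> | [-> | [-> | ->]]]. Qed.

Lemma qcont2_coord (h : R -> R -> quat) (c : quat -> R) :
  is_coord c -> qcont2 h -> forall x y, continuity_2d_pt (fun s t => c (h s t)) x y.
Proof.
  intros Hc H x y eps. destruct (H x y eps (cond_pos eps)) as (d & Hd & H').
  exists (mkposreal d Hd). simpl. intros s t Hs Ht. specialize (H' s t Hs Ht).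
  apply Rle_lt_trans with (2 := H').
  set (p := qadd _ _).
  replace (c (h s t) - c (h x y)) with (c p)
    by (unfold p; rewrite coord_qadd, coord_qscal by auto; ring).
  rewrite <- (Rabs_pos_eq (qnorm p)) by apply qnorm_ge_0.
  apply Rsqr_le_abs_0. rewrite !Rsqr_pow2. now apply coord_le_qnorm.
Qed.

Lemma qderiv_lim_coord (g : R -> quat) (t : R) (d : quat) (c : quat -> R) :
  is_coord c -> qderiv_lim g t d -> derivable_pt_lim (fun s => c (g s)) t (c d).
Proof. intros [-> | [-> | [-> | ->]]] H; apply H. Qed.

Lemma derivable_pt_lim_comb4 (g0 g1 g2 g3 : R -> R) (t d0 d1 d2 d3 k0 k1 k2 k3 : R) :
  derivable_pt_lim g0 t d0 -> derivable_pt_lim g1 t d1 ->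
  derivable_pt_lim g2 t d2 -> derivable_pt_lim g3 t d3 ->
  derivable_pt_lim (fun s => k0 * g0 s + k1 * g1 s + k2 * g2 s + k3 * g3 s) t
    (k0 * d0 + k1 * d1 + k2 * d2 + k3 * d3).
Proof.
  intros H0 H1 H2 H3.
  apply (derivable_pt_lim_plus (fun s => k0 * g0 s + k1 * g1 s + k2 * g2 s) (fun s => k3 * g3 s));
    [ apply (derivable_pt_lim_plus (fun s => k0 * g0 s + k1 * g1 s) (fun s => k2 * g2 s));
      [ apply (derivable_pt_lim_plus (fun s => k0 * g0 s) (fun s => k1 * g1 s)) |] |];
    now apply derivable_pt_lim_scal.
Qed.

Lemma derivable_pt_lim_eq (g h : R -> R) (t d e : R) :
  derivable_pt_lim g t d -> (forall s, g s = h s) -> d = e -> derivable_pt_lim h t e.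
Proof.
  intros H E <-. apply is_derive_Reals. apply is_derive_Reals in H.
  exact (is_derive_ext g h t d E H).
Qed.

Lemma qderiv_lim_qmul (J : quat) (g : R -> quat) (t : R) (d : quat) :
  qderiv_lim g t d -> qderiv_lim (fun s => qmul J (g s)) t (qmul J d).
Proof.
  intros (H0 & H1 & H2 & H3).
  pose proof (fun k0 k1 k2 k3 => derivable_pt_lim_comb4 _ _ _ _ t _ _ _ _ k0 k1 k2 k3 H0 H1 H2 H3) as H.
  repeat split; simpl; eapply derivable_pt_lim_eq.
  - exact (H (q0 J) (- q1 J) (- q2 J) (- q3 J)).
  - intros; simpl; ring.
  - ring.
  - exact (H (q1 J) (q0 J) (- q3 J) (q2 J)).
  - intros; simpl; ring.
  - ring.
  - exact (H (q2 J) (q3 J) (q0 J) (- q1 J)).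
  - intros; simpl; ring.
  - ring.
  - exact (H (q3 J) (- q2 J) (q1 J) (q0 J)).
  - intros; simpl; ring.
  - ring.
Qed.

Lemma quat_eq (p q : quat) : (forall c, is_coord c -> c p = c q) -> p = q.
Proof.
  intros H. pose proof (H q0) as E0. pose proof (H q1) as E1.
  pose proof (H q2) as E2. pose proof (H q3) as E3. unfold is_coord in *.
  destruct p, q; simpl in *. f_equal; tauto.
Qed.

(** Multiply the equation by [J] on the left and use [J * J = -1]. *)
Lemma cauchy_riemann_conj (J p q : quat) :
  in_S J -> qadd p (qmul J q) = qzero -> qmul J p = q.
Proof.
  intros [H0 H1] E. destruct J as [j0 j1 j2 j3], p as [p0' p1' p2' p3'], q as [r0 r1 r2 r3].
  simpl in H0, H1. subst j0. unfold qadd, qmul, qzero, qreal in *; simpl in *.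
  injection E as E0 E1 E2 E3.
  assert (S : j1 * j1 + j2 * j2 + j3 * j3 = 1) by lra.
  apply Rplus_opp_r_uniq in E0, E1, E2, E3.
  rewrite <- (Rmult_1_l r0), <- (Rmult_1_l r1), <- (Rmult_1_l r2), <- (Rmult_1_l r3), <- S.
  rewrite <- (Ropp_involutive p0'), <- (Ropp_involutive p1'), <- (Ropp_involutive p2'),
    <- (Ropp_involutive p3'), <- E0, <- E1, <- E2, <- E3.
  f_equal; ring.
Qed.

(* Left multiplication by [J] is the complex structure; a coordinate of [- J f]
   is the harmonic conjugate of the same coordinate of [f]. *)
Lemma slice_regular_hol (f : quat -> quat) (J : quat) (c : quat -> R) :
  slice_regular f -> in_S J -> is_coord c ->
  hol (fun x y => c (f (slice_pt J x y))) (fun x y => - c (qmul J (f (slice_pt J x y)))).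
Proof.
  intros Hf HJ Hc. destruct (Hf J HJ) as (dx & dy & Cx & Cy & Dx & Dy & E).
  assert (CX := qcont2_coord dx c Hc Cx). assert (CY := qcont2_coord dy c Hc Cy).
  assert (E1 : forall x y, qmul J (dx x y) = dy x y).
  (* [E1] and [E2] express the two partial derivatives of [- J f] by those of [f]. *)
  { intros x y. now apply cauchy_riemann_conj. }
  assert (E2 : forall x y, c (qmul J (dy x y)) = - c (dx x y)).
  { intros x y. pose proof (f_equal c (E x y)) as Q. rewrite coord_qadd in Q by auto.
    replace (c qzero) with 0 in Q by (destruct Hc as [-> | [-> | [-> | ->]]]; reflexivity). lra. }
  exists (fun x y => c (dx x y)), (fun x y => - c (dy x y)).
  repeat split; auto.
  - intros x y. rewrite Ropp_involutive.
    apply (differentiable_pt_lim_C1 (fun x y => c (f (slice_pt J x y)))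
             (fun x y => c (dx x y)) (fun x y => c (dy x y))); auto.
    + intros s t. apply (qderiv_lim_coord (fun s => f (slice_pt J s t))); auto.
    + intros s t. apply (qderiv_lim_coord (fun t => f (slice_pt J s t))); auto.
  - apply (differentiable_pt_lim_C1 (fun x y => - c (qmul J (f (slice_pt J x y))))
             (fun x y => - c (dy x y)) (fun x y => c (dx x y))).
    + intros s t. rewrite <- E1.
      apply (derivable_pt_lim_opp (fun s => c (qmul J (f (slice_pt J s t))))).
      apply (qderiv_lim_coord (fun s => qmul J (f (slice_pt J s t)))); auto.
      now apply qderiv_lim_qmul.
    + intros s t. rewrite <- (Ropp_involutive (c (dx s t))), <- E2.
      apply (derivable_pt_lim_opp (fun t => c (qmul J (f (slice_pt J s t))))).
      apply (qderiv_lim_coord (fun t => qmul J (f (slice_pt J s t)))); auto.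
      now apply qderiv_lim_qmul.
    + intros. apply continuity_2d_pt_opp, CY.
  - intros. apply continuity_2d_pt_opp, CY.
Qed.

Lemma slice_modulus_le (f : quat -> quat) (J : quat) (c : quat -> R) (q : quat) :
  in_S J -> is_coord c -> c (f q) ^ 2 + (- c (qmul J (f q))) ^ 2 <= 2 * qnorm (f q) ^ 2.
Proof.
  intros HJ Hc. pose proof (coord_le_qnorm c (f q) Hc).
  pose proof (coord_le_qnorm c (qmul J (f q)) Hc) as H1.
  rewrite (qnorm_qmul_S J _ HJ) in H1. nra.
Qed.

Lemma slice_type_zero (f : quat -> quat) (J : quat) (c : quat -> R) :
  slice_regular f ->
  (forall eps : R, 0 < eps ->
     exists R0 : R, forall q : quat, R0 < qnorm q -> qnorm (f q) < exp (eps * qnorm q)) ->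
  in_S J -> is_coord c ->
  type_zero (fun x y => c (f (slice_pt J x y))) (fun x y => - c (qmul J (f (slice_pt J x y)))).
Proof.
  intros Hf Hg HJ Hc e He.
  (* Halved because [type_zero] bounds the square of the modulus. *)
  destruct (Hg (e / 2)) as [R0 HR]; [ lra |].
  pose proof (slice_regular_hol f J c Hf HJ Hc) as H.
  destruct (continuity_2d_bounded
    (fun x y => c (f (slice_pt J x y)) * c (f (slice_pt J x y)) +
      (- c (qmul J (f (slice_pt J x y)))) * (- c (qmul J (f (slice_pt J x y)))))
    (- R0) R0 (- R0) R0) as [B HB].
  { intros x y _ _. pose proof (hol_continuity_l _ _ H x y). pose proof (hol_continuity_r _ _ H x y).
    apply continuity_2d_pt_plus; now apply continuity_2d_pt_mult. }
  (* The 2 comes from [slice_modulus_le] where the growth hypothesis applies; [B] covers the square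
     containing the other points. *)
  exists (2 + Rabs B). intros x y.
  assert (Ax := Rabs_pos x). assert (Ay := Rabs_pos y).
  assert (Qn := qnorm_slice_pt J x y HJ).
  assert (Q0 := qnorm_ge_0 (slice_pt J x y)).
  assert (Q2 : qnorm (slice_pt J x y) ^ 2 = x ^ 2 + y ^ 2).
  { rewrite Qn. apply pow2_sqrt. nra. }
  rewrite <- (pow2_abs x), <- (pow2_abs y) in Q2.
  assert (Q1 : qnorm (slice_pt J x y) <= Rabs x + Rabs y) by nra.
  assert (E1 : 1 <= exp (e * (Rabs x + Rabs y))).
  { rewrite <- exp_0. apply exp_le_exp. nra. }
  assert (PB := Rabs_pos B). assert (LB := Rle_abs B).
  destruct (Rlt_dec R0 (qnorm (slice_pt J x y))) as [L | L].
  - apply Rle_trans with (1 := slice_modulus_le f J c _ HJ Hc).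
    specialize (HR _ L). assert (F0 := qnorm_ge_0 (f (slice_pt J x y))).
    assert (F2 : qnorm (f (slice_pt J x y)) ^ 2 <= exp (e * (Rabs x + Rabs y))).
    { apply Rle_trans with (exp (e / 2 * qnorm (slice_pt J x y)) ^ 2).
      - apply pow_incr. lra.
      - replace (exp (e / 2 * qnorm (slice_pt J x y)) ^ 2)
          with (exp (e / 2 * qnorm (slice_pt J x y)) * exp (e / 2 * qnorm (slice_pt J x y))) by ring.
        rewrite <- exp_plus. apply exp_le_exp. nra. }
    nra.
  - assert (- R0 <= x <= R0).
    { apply Rabs_le_between. nra. }
    assert (- R0 <= y <= R0).
    { apply Rabs_le_between. nra. }
    specialize (HB x y ltac:(assumption) ltac:(assumption)). nra.
Qed.

Lemma slice_constant (f : quat -> quat) (J : quat) (a1 a2 b1 b2 M : R) :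
  slice_regular f ->
  (forall eps : R, 0 < eps ->
     exists R0 : R, forall q : quat, R0 < qnorm q -> qnorm (f q) < exp (eps * qnorm q)) ->
  in_S J -> b1 <> 0 \/ b2 <> 0 ->
  (forall t, qnorm (f (slice_pt J (a1 + t * b1) (a2 + t * b2))) <= M) ->
  forall x y, f (slice_pt J x y) = f (slice_pt J 0 0).
Proof.
  intros Hf Hg HJ Hb HM x y. apply quat_eq. intros c Hc.
  apply (hol_constant_of_bounded_line (fun x y => c (f (slice_pt J x y)))
           (fun x y => - c (qmul J (f (slice_pt J x y)))) a1 a2 b1 b2 (2 * M ^ 2)); auto.
  - now apply slice_regular_hol.
  - now apply slice_type_zero.
  - intros t. apply Rle_trans with (1 := slice_modulus_le f J c _ HJ Hc).
    specialize (HM t). apply Rmult_le_compat_l; [ lra |]. apply pow_incr.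
    split; auto. apply qnorm_ge_0.
Qed.

Lemma slice_pt_exists (q : quat) : exists J x y, in_S J /\ q = slice_pt J x y.
Proof.
  destruct q as [x a b c].
  destruct (Req_dec (a ^ 2 + b ^ 2 + c ^ 2) 0) as [E | E].
  - exists (mkQ 0 1 0 0), x, 0. split; [ split; simpl; ring |].
    unfold slice_pt, qadd, qreal, qscal; simpl. f_equal; nra.
  - assert (P : 0 < a ^ 2 + b ^ 2 + c ^ 2) by nra.
    set (r := sqrt (a ^ 2 + b ^ 2 + c ^ 2)).
    assert (Hr : 0 < r) by now apply sqrt_lt_R0.
    assert (R2 : r ^ 2 = a ^ 2 + b ^ 2 + c ^ 2) by (apply pow2_sqrt; lra).
    exists (mkQ 0 (a / r) (b / r) (c / r)), x, r. split.
    + split; simpl; [ reflexivity |].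
      transitivity ((a ^ 2 + b ^ 2 + c ^ 2) / r ^ 2); [ field; lra | rewrite <- R2; field; lra ].
    + unfold slice_pt, qadd, qreal, qscal; simpl. f_equal; field; lra.
Qed.

Lemma slice_pt_real (J : quat) (x : R) : slice_pt J x 0 = qreal x.
Proof. unfold slice_pt, qadd, qreal, qscal; simpl. f_equal; ring. Qed.

Theorem theorem4p9 (f : quat -> quat) :
  slice_regular f ->
  (forall eps : R, 0 < eps ->
     exists R0 : R, forall q : quat, R0 < qnorm q ->
       qnorm (f q) < exp (eps * qnorm q)) ->
  (exists I a b : quat,
     in_S I /\ in_L I a /\ in_L I b /\ b <> qzero /\
     exists M : R, forall t : R, qnorm (f (qadd a (qscal t b))) <= M) ->
  exists c : quat, forall q : quat, f q = c.
Proof.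
  intros Hf Hg (I & a & b & HI & (a1 & a2 & ->) & (b1 & b2 & ->) & Hb & M & HM).
  assert (Hb' : b1 <> 0 \/ b2 <> 0).
  { destruct (Req_dec b1 0) as [-> |]; [| tauto].
    destruct (Req_dec b2 0) as [-> |]; [| tauto].
    exfalso. apply Hb, slice_pt_real. }
  assert (H0 : forall x, f (qreal x) = f (qreal 0)).
  { intros x. rewrite <- (slice_pt_real I x), <- (slice_pt_real I 0).
    apply (slice_constant f I a1 a2 b1 b2 M); auto. intros t.
    replace (slice_pt I (a1 + t * b1) (a2 + t * b2))
      with (qadd (slice_pt I a1 a2) (qscal t (slice_pt I b1 b2))); auto.
    unfold slice_pt, qadd, qreal, qscal; simpl. f_equal; ring. }
  exists (f (qreal 0)). intros q.
  destruct (slice_pt_exists q) as (J & x & y & HJ & ->).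
  rewrite <- (slice_pt_real J 0).
  (* In the slice of [J] the bounded line is the real axis, on which [f] is already known to be
     constant. *)
  apply (slice_constant f J 0 0 1 0 (qnorm (f (qreal 0)))); auto.
  intros t. replace (0 + t * 0) with 0 by ring.
  rewrite slice_pt_real, H0. apply Rle_refl.
Qed.
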